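(* Let $\mathcal{A}_T$ be the set of all binary Tribonacci-automatic infinite sequences. Then $\mathrm{rt}(\mathcal{A}_T)=7/3$.
   Context: Tribonacci numbers: $T_0=0,T_1=1,T_2=1$, $T_n=T_{n-1}+T_{n-2}+T_{n-3}$. In the Tribonacci numeration system each natural number is written uniquely (greedily) as a sum of distinct Tribonacci numbers $T_i$ with $i\ge3$ (i.e., $1,2,4,7,13,\dots$) such that the resulting binary digit word contains no three consecutive $1$'s. A sequence $(a_n)_{n\ge0}$ is Tribonacci-automatic if a deterministic finite automaton with output, on input the Tribonacci representation of $n$ (most significant digit first), outputs $a_n$. For a finite word $w=w[1..n]$, $p$ ($1\le p\le n$) is a period if $w[i]=w[i+p]$ for $1\le i\le n-p$; $\exp(w)=n/p$ for the smallest period $p$. The critical exponent $\mathrm{ce}(\mathbf{x})$ of an infinite word is the supremum of $\exp(w)$ over finite nonempty factors $w$; for a nonempty set $S$ of infinite words, $\mathrm{rt}(S)=\inf_{\mathbf{x}\in S}\mathrm{ce}(\mathbf{x})$. *)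

(* Defs.v *)
From mathcomp Require Import all_boot all_order all_algebra.
From mathcomp Require Import zify.
From mathcomp Require Import boolp classical_sets reals constructive_ereal ereal.

Set Implicit Arguments.
Unset Strict Implicit.
Unset Printing Implicit Defensive.

Import Order.TTheory GRing.Theory Num.Theory.

Local Open Scope nat_scope.

Fixpoint trib (n : nat) : nat :=
  match n with
  | 0 => 0
  | 1 => 1
  | 2 => 1
  | ((m.+1 as m1).+1 as m2).+1 => trib m2 + trib m1 + trib m
  end.
Arguments trib n : simpl never.

(* Words of digits are written most significant digit first; the least
   significant digit has weight trib 2 = 1, so the weights are 1, 2, 4, 7, 13... *)
Fixpoint trib_val (w : seq bool) : nat :=
  if w is d :: w' then d * trib (size w').+2 + trib_val w' else 0.

Fixpoint greedy (k n : nat) : seq bool :=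
  if k is k'.+1 then
    if trib k'.+2 <= n then true :: greedy k' (n - trib k'.+2)
    else false :: greedy k' n
  else [::].

Definition strip_zeros (w : seq bool) : seq bool := drop (find id w) w.

(* n digits are enough because n < trib n.+2; the representation of 0 is the
   empty word.  The lemma trib_repP below characterizes trib_rep n as the unique
   word of value n without leading zero and without three consecutive ones. *)
Definition trib_rep (n : nat) : seq bool := strip_zeros (greedy n n).

Lemma tribSSS n : trib n.+3 = trib n.+2 + trib n.+1 + trib n.
Proof. by []. Qed.

Lemma trib_le n : trib n <= trib n.+1.
Proof. by case: n => [|[|n]] //; rewrite tribSSS; lia. Qed.

Lemma trib_gt0 n : 0 < trib n.+1.
Proof. by elim: n => // n; have := trib_le n.+1; lia. Qed.

Lemma trib_gt n : n < trib n.+2.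
Proof.
by elim: n => // n IH; rewrite tribSSS; have := trib_gt0 n; lia.
Qed.

Lemma trib_sub k : trib k.+1 + trib k <= trib k.+2.
Proof. by case: k => // k; rewrite tribSSS; lia. Qed.

Lemma size_greedy k n : size (greedy k n) = k.
Proof. by elim: k n => //= k IH n; case: ifP => _ /=; rewrite IH. Qed.

Lemma greedy_sub k n : n < trib k.+3 -> n - trib k.+2 < trib k.+2.
Proof.
by rewrite tribSSS; have := trib_sub k; have := trib_gt0 k.+1; lia.
Qed.

Lemma greedy_val k n : n < trib k.+2 -> trib_val (greedy k n) = n.
Proof.
elim: k n => [|k IH] n; first by case: n.
move=> lt_n /=; case: ifP => le_n /=; rewrite ?size_greedy IH.
- by rewrite mul1n subnKC.
- exact: greedy_sub.
- by rewrite mul0n.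
- by rewrite ltnNge le_n.
Qed.

Lemma greedy_no111 k n :
  n < trib k.+2 -> ~~ infix [:: true; true; true] (greedy k n).
Proof.
elim: k n => [|k IH] n lt_n; first by [].
have val_n := greedy_val lt_n.
have IH' : ~~ infix [:: true; true; true] (behead (greedy k.+1 n)).
  rewrite /=; case: ifP => le_n /=; apply: IH; first exact: greedy_sub.
  by rewrite ltnNge le_n.
have size_n := size_greedy k.+1 n.
case: (greedy k.+1 n) val_n IH' size_n => // d1 w val_n /= IH' size_n.
rewrite negb_or IH' andbT; apply/negP.
case: w {IH'} val_n size_n => [|[] [|[] w]] //=; case: d1 => //=.
by move=> val_n [size_n]; move: lt_n; rewrite -size_n -val_n /= [X in _ < X]tribSSS; lia.
Qed.

Lemma trib_val_lt w :
  ~~ infix [:: true; true; true] w -> trib_val w < trib (size w).+2.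
Proof.
have [m] := ubnP (size w); elim: m w => // m IH.
have step w : size w < m -> ~~ infix [:: true; true; true] (false :: w) ->
    trib_val w < trib (size w).+2 by move=> sz nw; apply: IH.
case=> [|[|] w] // sz nw; last first.
  by have := step w sz nw; have := trib_le (size w).+2; rewrite /=; lia.
case: w sz nw => [|[|] w] // sz nw; last first.
  have := step w (ltnW sz) nw.
  by have := tribSSS (size w).+1; rewrite /=; lia.
case: w sz nw => [|[|] w] // sz nw; first by move: nw; rewrite /= prefix0s.
have := step w (ltnW (ltnW sz)) nw.
by have := tribSSS (size w).+2; rewrite /=; lia.
Qed.

Lemma greedy_of_val w :
  ~~ infix [:: true; true; true] w -> greedy (size w) (trib_val w) = w.
Proof.
elim: w => // d w IH nw.
have nw' : ~~ infix [:: true; true; true] w by move: nw; rewrite /= negb_or => /andP[].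
have lt_w := trib_val_lt nw'.
case: d {nw} => /=.
  by rewrite mul1n leq_addr addKn IH.
by rewrite mul0n add0n leqNgt lt_w /= IH.
Qed.

Lemma strip_greedy j k n :
  n < trib k.+2 -> strip_zeros (greedy (j + k) n) = strip_zeros (greedy k n).
Proof.
move=> lt_n; elim: j => // j IH; rewrite addSn /=.
have: n < trib (j + k).+2.
  by elim: j {IH} => // j IH; rewrite addSn; apply: leq_trans IH (trib_le _).
by rewrite ltnNge => /negbTE ->.
Qed.

Lemma trib_val_strip w : trib_val (strip_zeros w) = trib_val w.
Proof. by rewrite /strip_zeros; elim: w => // -[] w IH //=; rewrite IH. Qed.

Lemma head_strip w : head true (strip_zeros w).
Proof. by rewrite /strip_zeros; elim: w => // -[] w IH. Qed.

Lemma strip_head w : head true w -> strip_zeros w = w.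
Proof. by case: w => // -[]. Qed.

Lemma trib_repP n w :
  trib_rep n = w <->
  [/\ trib_val w = n, head true w & ~~ infix [:: true; true; true] w].
Proof.
split=> [<-|[<- hw nw]].
  split; [by rewrite trib_val_strip greedy_val ?trib_gt | exact: head_strip |].
  apply: contra (greedy_no111 (trib_gt n)) => /infix_trans; apply.
  by apply: suffixW; rewrite /strip_zeros suffix_drop.
rewrite /trib_rep; set v := trib_val w.
have vlt : v < trib (size w).+2 by exact: trib_val_lt.
rewrite -(strip_greedy (size w) (trib_gt v)) addnC strip_greedy //.
by rewrite greedy_of_val // strip_head.
Qed.

Record dfao (A : Type) := Dfao {
  dfao_state : finType;
  dfao_init : dfao_state;
  dfao_trans : dfao_state -> bool -> dfao_state;
  dfao_out : dfao_state -> A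
}.

Definition dfao_run (A : Type) (M : dfao A) (w : seq bool) : A :=
  dfao_out (foldl (@dfao_trans A M) (dfao_init M) w).

Definition trib_automatic (A : Type) (a : nat -> A) : Prop :=
  exists M : dfao A, forall n, dfao_run M (trib_rep n) = a n.

Definition binary_trib_automatic : set (nat -> bool) :=
  [set a : nat -> bool | trib_automatic a]%classic.

Definition is_period (A : eqType) (w : seq A) (p : nat) : bool :=
  (0 < p <= size w) &&
  [forall i : 'I_(size w - p), onth w i == onth w (i + p)].

(* For nonempty w, the default value size w is itself a period of w, so this is
   the minimum of the set of periods, as least_periodP states. *)
Definition least_period (A : eqType) (w : seq A) : nat :=
  \big[minn/size w]_(1 <= p < (size w).+1 | is_period w p) p.

Lemma least_periodP (A : eqType) (w : seq A) : w <> [::] ->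
  is_period w (least_period w) /\
  (forall p, is_period w p -> least_period w <= p).
Proof.
move=> w0; have per_size : is_period w (size w).
  rewrite /is_period leqnn andbT; apply/andP; split; first by case: (w) w0.
  by apply/forallP => -[i lt_i]; move: (lt_i); rewrite subnn.
rewrite /least_period; split.
  by elim/big_ind: _ => // p q per_p per_q; rewrite /minn; case: ifP.
move=> p per_p; have /andP[/andP[p0 ple] _] := per_p.
have p_in : p \in index_iota 1 (size w).+1 by rewrite mem_index_iota p0 ltnS.
elim: (index_iota _ _) p_in => // q r IH; rewrite in_cons big_cons.
case/predU1P => [<-|/IH le_p]; first by rewrite per_p geq_minl.
by case: ifP => // _; rewrite geq_min le_p orbT.
Qed.

Definition is_factor (A : Type) (x : nat -> A) (w : seq A) : Prop :=
  exists i : nat, w = mkseq (fun j => x (i + j)) (size w).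

Section RepetitionThreshold.
Local Open Scope ring_scope.
Local Open Scope classical_set_scope.

Variables (R : realType) (A : eqType).

Definition exponent (w : seq A) : R := (size w)%:R / (least_period w)%:R.

Definition critical_exponent (x : nat -> A) : \bar R :=
  ereal_sup [set (exponent w)%:E | w in [set w | is_factor x w /\ w <> [::]]].

Definition repetition_threshold (S : set (nat -> A)) : \bar R :=
  ereal_inf [set critical_exponent x | x in S].

End RepetitionThreshold.

Arguments exponent R {A} w.
Arguments critical_exponent R {A} x.
Arguments repetition_threshold R {A} S.

(* Main.v *)
(* Lower bound. An infinite binary word without factors of exponent at least 7/3
   is, up to a prefix, the Thue-Morse image of another such word, so occurrences
   of a long common factor are congruent modulo a large power of 2.  In a
   Tribonacci-automatic word two inputs 10..0 lead to the same state, so there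
   are m <> m' such that the positions trib (m + n) and trib (m' + n) start
   longer and longer common factors as n grows.  The recurrence, run backwards,
   turns the congruence for large n into one for n = 0, whence
   trib m = trib m', a contradiction.

   Upper bound. Decorate the Tribonacci word with the parities of the number of
   ones at even and at odd places of the representation of n.  The periods of
   squares of the Tribonacci word change one of these parities, hence the
   decorated word has no long almost-squares.  This is proved by descent through
   the square of its morphism.  Its image by a suitable 12-letter coding into blocks of
   lengths 7, 6 and 4 has no long squares, again by descent, and short periods
   are checked exhaustively. *)

Require Import Defs.
From mathcomp Require Import all_boot all_order all_algebra zify.
From mathcomp Require Import boolp classical_sets reals constructive_ereal ereal.

Set Implicit Arguments.
Unset Strict Implicit.
Unset Printing Implicit Defensive.

Import Order.TTheory GRing.Theory Num.Theory.

Local Open Scope nat_scope.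

(** * Repetitions in images under a morphism *)

(** For [p > 0]: the factor of length [p + n] at [i] has period [p]. *)
Definition matches (A : Type) (x : nat -> A) (i p n : nat) : Prop :=
  forall k, k < n -> x (i + k) = x (i + p + k).

Section Image.

Variables (A B : Type) (f : A -> seq B) (y : nat -> A) (x : nat -> B) (b0 : B).

Definition block_pos (j : nat) : nat := \sum_(i < j) size (f (y i)).

Definition is_image : Prop :=
  forall j r, r < size (f (y j)) -> x (block_pos j + r) = nth b0 (f (y j)) r.

Definition recognizable (W : nat) : Prop :=
  forall j j' r, r < size (f (y j')) ->
    (forall k, k < W -> x (block_pos j + k) = x (block_pos j' + r + k)) ->
  y j = y j' /\ r = 0.

Variables m M : nat.
Hypothesis m_gt0 : 0 < m.
Hypothesis size_f : forall a, m <= size (f a) <= M.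

Lemma block_posS j : block_pos j.+1 = block_pos j + size (f (y j)).
Proof. by rewrite /block_pos big_ord_recr. Qed.

Lemma block_pos_bounds j k :
  block_pos j + m * k <= block_pos (j + k) <= block_pos j + M * k.
Proof.
elim: k => [|k IH]; first by rewrite !muln0 !addn0 leqnn.
rewrite addnS block_posS !mulnS; have := size_f (y (j + k)); lia.
Qed.

Lemma block_posP i : exists j r, r < size (f (y j)) /\ i = block_pos j + r.
Proof.
elim: i => [|i [j [r [lt_r ->]]]].
  exists 0, 0; split; last by rewrite /block_pos big_ord0.
  by have := size_f (y 0); lia.
have [lt_r1|le_r] := ltnP r.+1 (size (f (y j))); first by exists j, r.+1; rewrite addnS.
exists j.+1, 0; split; first by have := size_f (y j.+1); lia.
rewrite block_posS; lia.
Qed.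

Lemma block_start_ge i : exists j, i <= block_pos j < i + M.
Proof.
have [j [r [lt_r ->]]] := block_posP i.
case: r lt_r => [|r] lt_r.
  by exists j; have := size_f (y j); lia.
exists j.+1; rewrite block_posS; have := size_f (y j); lia.
Qed.

(* The slack c' absorbs the block cut at the left end, the window W and c. *)
Lemma matches_descent W c c' i p :
    is_image -> recognizable W ->
    c + W + M <= (m * c'.+1).+1 -> c + W + M <= p.+1 -> 0 < p ->
    matches x i p (p - c) ->
  exists i' p', matches y i' p' (p' - c') /\ m * p' <= p <= M * p'.
Proof.
move=> im rec le_c le_p p_gt0 mat.
have [j0 /andP[ge_i lt_i]] := block_start_ge i.
have win j : i <= block_pos j -> block_pos j + W <= i + (p - c) ->
    forall k, k < W -> x (block_pos j + k) = x (block_pos j + p + k).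
  move=> ge_j le_j k lt_k.
  have := mat (block_pos j - i + k); rewrite addnA subnKC // => ->; last by lia.
  by congr (x _); lia.
have [j1 [r [lt_r e_r]]] := block_posP (block_pos j0 + p).
have [|y_j0 r0] := rec j0 j1 r lt_r.
  by move=> k lt_k; rewrite -e_r; apply: win => //; lia.
rewrite {}r0 addn0 in e_r.
have lt_j : j0 < j1.
  rewrite ltnNge; apply/negP => le_j.
  have /andP[/(leq_trans (leq_addr _ _))] := block_pos_bounds j1 (j0 - j1).
  by rewrite subnKC //; lia.
set p' := j1 - j0; have e_j1 : j1 = j0 + p' by rewrite /p' subnKC // ltnW.
have bnd := block_pos_bounds j0 p'; rewrite -e_j1 -e_r in bnd.
exists j0, p'; split; last by lia.
(* At least [c'.+1] blocks lie from block [j0 + k] up to [j1]; they leave room for the window [W],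
   the slack [c] and the fewer than [M] letters cut off on the left. *)
have room k : k < p' - c' -> block_pos (j0 + k) + W <= i + (p - c).
  move=> lt_k; have := block_pos_bounds (j0 + k) (p' - k).
  have -> : j0 + k + (p' - k) = j1 by lia.
  have : m * c'.+1 <= m * (p' - k) by rewrite leq_mul2l; lia.
  rewrite -e_r; lia.
have step k : k < p' - c' -> block_pos (j0 + k) + p = block_pos (j0 + p' + k) ->
    y (j0 + k) = y (j0 + p' + k).
  move=> lt_k e_k; have le_k := room k lt_k.
  have ge_k := block_pos_bounds j0 k.
  have [||//] := rec (j0 + k) (j0 + p' + k) 0.
    by have := size_f (y (j0 + p' + k)); lia.
  by move=> l lt_l; rewrite addn0 -e_k; apply: win => //; lia.
(* Equal letters have blocks of equal length, so the boundaries stay [p] apart. *)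
have pos k : k < p' - c' -> block_pos (j0 + k) + p = block_pos (j0 + p' + k).
  elim: k => [|k IH] lt_k; first by rewrite !addn0 e_r e_j1.
  have e_k := IH (ltnW lt_k).
  rewrite !addnS !block_posS -(step k) ?(ltnW lt_k) //; lia.
by move=> k lt_k; apply: step => //; apply: pos.
Qed.

End Image.

(** * Words without factors of exponent at least 7/3 *)

(** [4 * p <= 3 * e] says that [(p + e) / p] is at least 7/3. *)
Definition avoids_7_3 (a : nat -> bool) : Prop :=
  forall i p e, 0 < p -> 4 * p <= 3 * e -> ~ matches a i p e.

Lemma avoids_7_3_all a i p e : avoids_7_3 a -> 0 < p -> 4 * p <= 3 * e ->
  ~~ all (fun k => a (k + i) == a (k + p + i)) (iota 0 e).
Proof.
move=> av p_gt0 le_p; apply/negP => /allP mat; apply: (av i p e) => // k lt_k.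
have := mat k; rewrite mem_iota => /(_ lt_k) /eqP.
by rewrite [k + i]addnC => ->; congr (a _); lia.
Qed.

(** At distance three, the next square of a letter would complete 1001001 up to complement, since
    cubes are excluded; this uses the letter [a l] before the square. A wait beyond distance four
    contains 01010 or its complement. So the distance is two or four. *)
Lemma avoids_7_3_square a l : avoids_7_3 a -> a l.+1 = a l.+2 ->
  a l.+2 != a l.+3 /\
  (a l.+3 = a l.+4 \/ a l.+4 != a l.+4.+1 /\ a l.+4.+1 = a l.+4.+2).
Proof.
move=> av.
have := avoids_7_3_all l av (isT : 0 < 3) (isT : 4 * 3 <= 3 * 4).
have := avoids_7_3_all l.+2 av (isT : 0 < 2) (isT : 4 * 2 <= 3 * 3).
have := avoids_7_3_all l av (isT : 0 < 1) (isT : 4 * 1 <= 3 * 2).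
have := avoids_7_3_all l.+1 av (isT : 0 < 1) (isT : 4 * 1 <= 3 * 2).
have := avoids_7_3_all l.+4 av (isT : 0 < 1) (isT : 4 * 1 <= 3 * 2).
rewrite /= !add0n !(addSn, add0n).
by case: (a l) (a l.+1) (a l.+2) (a l.+3) (a l.+4) (a l.+4.+1) (a l.+4.+2)
  => [] [] [] [] [] [] [] //=; auto.
Qed.

Lemma square_parity a l k : avoids_7_3 a -> a l.+1 = a l.+2 ->
  a (l.+2 + k.*2) != a (l.+2 + k.*2).+1.
Proof.
move=> av; have [n] := ubnP k; elim: n l k => // n IH l k lt_k eq_l.
have [neq_l next] := avoids_7_3_square av eq_l.
case: k lt_k => [|k] lt_k; first by rewrite addn0.
case: next => [eq_l2|[neq_l2 eq_l4]].
  by have := IH l.+2 k lt_k eq_l2; rewrite doubleS !addSn !addnS.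
case: k lt_k => [|k] lt_k; first by rewrite !addnS addn0.
by have := IH l.+4 k (ltnW lt_k) eq_l4; rewrite !doubleS !addSn !addnS.
Qed.

(** Five alternating letters have exponent 5/2. *)
Lemma square_near a l : avoids_7_3 a -> exists2 o, o < 4 & a (l + o) = a (l + o).+1.
Proof.
move=> av; have := avoids_7_3_all l av (isT : 0 < 2) (isT : 4 * 2 <= 3 * 3).
rewrite /= !(addSn, add0n) => nmat.
have [e0|n0] := eqVneq (a l) (a l.+1); first by exists 0; rewrite ?addn0.
have [e1|n1] := eqVneq (a l.+1) (a l.+2); first by exists 1; rewrite ?addn1.
have [e2|n2] := eqVneq (a l.+2) (a l.+3); first by exists 2; rewrite ?addn2.
have [e3|n3] := eqVneq (a l.+3) (a l.+4); first by exists 3; rewrite ?addn3.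
by move: nmat n0 n1 n2 n3; do 5!case: (a _).
Qed.

(* The word k |-> a (s + 2k) is the preimage of a, shifted by s, under
   0 |-> 01, 1 |-> 10. *)
Lemma desubstitution a : avoids_7_3 a -> exists s,
  (forall k, a (s + k.*2) != a (s + k.*2).+1) /\
  avoids_7_3 (fun k => a (s + k.*2)).
Proof.
(* The search starts at 1, since [square_parity] asks for a letter before the square. *)
move=> av; have [o lt_o eq_o] := square_near 1 av.
have neq k := square_parity k av eq_o.
exists o.+2; split=> // i p e p_gt0 le_p mat.
apply: (av (o.+2 + i.*2) p.*2 e.*2); [by lia | by lia |] => k lt_k.
rewrite -(odd_double_half k).
have lt_h : k./2 < e by lia.
have := mat k./2 lt_h.
have -> : o.+2 + (i + k./2).*2 = o.+2 + i.*2 + k./2.*2 by lia.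
have -> : o.+2 + (i + p + k./2).*2 = o.+2 + i.*2 + p.*2 + k./2.*2 by lia.
move=> eq_a; case: (odd k); last by rewrite !add0n.
have := neq (i + k./2); have := neq (i + p + k./2).
have -> : o.+2 + (i + k./2).*2 = o.+2 + i.*2 + k./2.*2 by lia.
have -> : o.+2 + (i + p + k./2).*2 = o.+2 + i.*2 + p.*2 + k./2.*2 by lia.
by rewrite eq_a !add1n !addnS; do 3!case: (a _).
Qed.

(** Induction on [k]: a square of a letter inside the common factor forces [p] and [q] to have the
    same parity, and halving the positions passes to the preimage word. *)
Lemma synchronization k a : avoids_7_3 a -> exists C, forall p q,
  (forall j, j < C -> a (p + j) = a (q + j)) -> p = q %[mod 2 ^ k].
Proof.
elim: k a => [|k IH] a av; first by exists 0 => p q _; rewrite !modn1.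
have [s [neq av']] := desubstitution av; have [C sync] := IH _ av'.
exists (C.*2 + s + 6) => p q eq_pq.
have [o lt_o eq_o] := square_near (p + s) av.
have parity n : s <= n -> a n = a n.+1 -> odd (n + s).
  move=> le_s; apply: contra_eqT => ev; have := neq (n - s)./2.
  by have -> : s + ((n - s)./2).*2 = n by lia.
have odd_p : odd (p + s + o + s) by apply: parity; first lia.
have odd_q : odd (q + s + o + s).
  apply: parity; first lia.
  by move: eq_o; rewrite -!addnS -!addnA !eq_pq //; lia.
(* Shifting by [t] moves both positions to the start of a block 01 or 10. *)
pose t := s + odd p.
have e_p : p + t = s + ((p + odd p)./2).*2 by rewrite /t; lia.
have e_q : q + t = s + ((q + odd p)./2).*2 by rewrite /t; lia.
have /sync : forall j, j < C -> a (s + ((p + odd p)./2 + j).*2) =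
                                a (s + ((q + odd p)./2 + j).*2).
  move=> j lt_j; rewrite !doubleD !addnA -e_p -e_q -!addnA; apply: eq_pq.
  by rewrite /t; lia.
move=> /eqP eq_h; apply/eqP; rewrite -(eqn_modDr t) e_p e_q eqn_modDl.
by rewrite expnS -!muln2 ![_ * 2]mulnC -!muln_modr // (eqP eq_h).
Qed.

(** * Tribonacci-automatic words and synchronization *)

Lemma no111_nseq m w : ~~ infix [:: true; true; true] w ->
  ~~ infix [:: true; true; true] (nseq m false ++ w).
Proof. by move=> nw; elim: m. Qed.

Lemma trib_val_nseq m w : trib_val (nseq m false ++ w) = trib_val w.
Proof. by elim: m. Qed.

Lemma trib_rep_shift m n r : r < trib n.+2 ->
  trib_rep (trib (m + n).+3 + r) = true :: nseq m.+1 false ++ greedy n r.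
Proof.
move=> lt_r; apply/trib_repP; split=> //.
  by rewrite /= trib_val_nseq size_cat size_nseq size_greedy greedy_val ?mul1n.
exact/no111_nseq/greedy_no111.
Qed.

Lemma trib_ltn m n : m < n -> trib m.+2 < trib n.+2.
Proof.
have lt_S k : trib k.+2 < trib k.+3 by rewrite [X in _ < X]tribSSS; have := trib_gt0 k; lia.
elim: n => // n IH; rewrite ltnS leq_eqVlt => /predU1P[->//|/IH lt_m].
exact: ltn_trans lt_m (lt_S n).
Qed.

Theorem trib_automatic_7_3 a : trib_automatic a -> ~ avoids_7_3 a.
Proof.
case=> M run av.
pose q (m : nat) := foldl (@dfao_trans _ M) (dfao_init M) (true :: nseq m.+1 false).
have [m1 [m2 [lt_m eq_q]]] : exists m1 m2, m1 < m2 /\ q m1 = q m2.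
  have /injectivePn[i [j neq_ij eq_ij]] :
      ~~ injectiveb (fun i : 'I_(#|dfao_state M|.+1) => q i).
    apply/negP => /injectiveP /leq_card; by rewrite card_ord ltnn.
  case: (ltngtP i j) => [lt_ij|lt_ji|/val_inj e_ij]; last first.
  - by rewrite e_ij eqxx in neq_ij.
  - by exists j, i.
  - by exists i, j.
have agree n r : r < trib n.+2 ->
    a (trib (m1 + n).+3 + r) = a (trib (m2 + n).+3 + r).
  move=> lt_r; rewrite -!run !trib_rep_shift //.
  by rewrite /dfao_run -!cat_cons !foldl_cat -/(q m1) -/(q m2) eq_q.
have cong k n : trib (m1 + n).+3 = trib (m2 + n).+3 %[mod 2 ^ k].
  have [C sync] := synchronization k av.
  have [N] := ubnP (C - n); elim: N n => // N IH n lt_N.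
  have [le_C|lt_C] := leqP C n.
    by apply: sync => j lt_j; apply: agree; have := trib_gt n; lia.
  have rec m : trib (m + n).+3 + (trib (m + n.+1).+3 + trib (m + n.+2).+3) =
      trib (m + n.+3).+3 by rewrite !addnS [RHS]tribSSS; lia.
  (* Downward from C: the recurrence expresses term n by terms n+1, n+2, n+3. *)
  have := IH n.+3; rewrite -!rec => e3; apply/eqP.
  rewrite -(eqn_modDr (trib (m1 + n.+1).+3 + trib (m1 + n.+2).+3)) e3; last by lia.
  rewrite eqn_modDl; apply/eqP; rewrite -modnDm -[RHS]modnDm.
  by rewrite (IH n.+1) ?(IH n.+2) //; lia.
(* The modulus exceeds both numbers, so the congruence becomes an equality. *)
have := cong (trib m2.+3) 0; rewrite !addn0 !modn_small.
- by have := trib_ltn (lt_m : m1.+1 < m2.+1); lia.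
- exact: ltn_expl.
- by have := @trib_ltn m1.+1 m2.+1 lt_m; have := @ltn_expl 2 (trib m2.+3) isT; lia.
Qed.

(** * The decorated Tribonacci word and its binary coding *)

(* ((a, b), t) records what has been read so far: a and b are the parities of
   the number of ones at even and odd places, counted from the last digit, and
   t = None, Some false, Some true stands for 0, 1, 2 trailing ones. *)
Definition letter : Type := (bool * bool * option bool)%type.

Definition letter0 : letter := (false, false, None).

(** Appending a digit shifts all places by one, which exchanges the two parities. *)
Definition delta (l : letter) (d : bool) : letter :=
  let: (a, b, t) := l in
  ((b (+) d, a), if d then Some (t != None) else None).

Definition can_add_one (l : letter) : bool := l.2 != Some true.

(** Iterates of the morphism that sends a letter to its successors under the admissible digits, in
    increasing order of value. *)
Fixpoint expand (k : nat) (l : letter) : seq letter :=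
  if k is k'.+1 then
    expand k' (delta l false) ++
    (if can_add_one l then expand k' (delta l true) else [::])
  else [:: l].

(* The blocks were found by a backtracking search. *)
Definition coding (l : letter) : seq bool :=
  let: (a, b, t) := l in
  map (addb a)
    match a (+) b, t with
    | false, None => [:: false; true; true; false; true; false; false]
    | true, None => [:: false; true; false; false; true; true; false]
    | false, Some false => [:: true; false; true; false; false; true]
    | true, Some false => [:: false; false; true; false; false; true]
    | false, Some true => [:: false; false; true; true]
    | true, Some true => [:: false; false; true; false]
    end.

(* Vacuously true beyond the end of the shorter word, so that only its negation
   carries information.  The conditional stops the evaluation at the first
   mismatch, which a boolean conjunction would not do under vm_compute. *)
Fixpoint agree (B : eqType) (e : nat) (u v : seq B) : bool :=
  match e, u, v with
  | e'.+1, b :: u', c :: v' => if b == c then agree e' u' v' else false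
  | _, _, _ => true
  end.

(** Collected from a prefix; [pair_mem] shows that no pair is missing. *)
Definition pairs : seq (letter * letter) :=
  let w := expand 7 letter0 in undup (zip w (behead w)).

(* The blocks are long, so a factor of moderate length meets at most two. *)
Definition factors (n : nat) : seq (seq letter) :=
  [seq drop r (expand n ab.1 ++ expand n ab.2) |
    ab <- pairs, r <- iota 0 (size (expand n ab.1))].

Definition no_match (B : eqType) (e : nat -> nat) (ps : seq nat) (w : seq B) : bool :=
  all (fun p => ~~ agree (e p) w (drop p w)) ps.

Definition recognizableb (B : eqType) (f : letter -> seq B) (n W : nat) : bool :=
  let T := [seq (head letter0 w, flatten (map f w)) | w <- factors n] in
  all (fun s => all (fun t =>
    all (fun r => agree W s.2 (drop r t.2) ==> (s.1 == t.1) && (r == 0))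
      (iota 0 (size (f t.1)))) T) T.

Lemma agreeP (B : eqType) (b0 : B) e u v :
  (forall k, k < e -> k < size u -> k < size v -> nth b0 u k = nth b0 v k) ->
  agree e u v.
Proof.
elim: e u v => // e IH [|b u] [|c v] //= eq_uv.
have -> : b = c by exact: (eq_uv 0).
rewrite eqxx; apply: IH => k lt_e lt_u lt_v.
exact: (eq_uv k.+1).
Qed.

Lemma size_expand k ab t : size (expand k (ab, t)) =
  match t with
  | None => trib k.+2
  | Some false => trib k.+1 + trib k
  | Some true => trib k.+1
  end.
Proof.
elim: k ab t => [|k IH] [a b] t; first by case: t => [[]|].
rewrite /= size_cat IH; case: t => [[]|] /=; rewrite ?IH ?addn0 //.
by rewrite [RHS]tribSSS addnA.
Qed.

Lemma size_expand_bounds k l : 0 < size (expand k l) <= trib k.+2.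
Proof.
case: l => ab t; rewrite size_expand.
have := trib_gt0 k; have := trib_gt0 k.+1; have := trib_sub k; have := trib_le k.+1.
by case: t => [[]|]; lia.
Qed.

Lemma expandD k l : forall a, expand (k + l) a = flatten (map (expand l) (expand k a)).
Proof.
elim: k => [|k IH] a; first by rewrite /= cats0.
by rewrite addSn /= map_cat flatten_cat !IH; case: ifP => //; rewrite IH.
Qed.

Lemma size_expand2 l : 2 <= size (expand 2 l) <= 4.
Proof. by case: l => [[[] []] [[]|]]. Qed.

Lemma size_coding_expand l : size (coding l) = size (expand 3 l).
Proof. by case: l => [[[] []] [[]|]]. Qed.

Lemma size_coding l : 4 <= size (coding l) <= 7.
Proof. by case: l => [[[] []] [[]|]]. Qed.

(** * The automaton and the words it generates *)

Definition state : Type := (letter * (bool * bool * bool))%type.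

(* The letter is updated with a delay of three digits, which then select a
   position in its block: blocks have the lengths of expand 3. *)
Definition trans (s : state) (d : bool) : state :=
  let: (l, (d1, d2, d3)) := s in (delta l d1, (d2, d3, d)).

Definition out (s : state) : bool :=
  let: (l, (d1, d2, d3)) := s in nth false (coding l) (trib_val [:: d1; d2; d3]).

Definition state0 : state := (letter0, (false, false, false)).

Definition coding_dfao : dfao bool := @Dfao bool state state0 trans out.

Definition letter_word (n : nat) : letter := foldl delta letter0 (trib_rep n).

Definition bit_word (n : nat) : bool := dfao_run coding_dfao (trib_rep n).

Lemma trib_rep_greedy k n : n < trib k.+2 -> strip_zeros (greedy k n) = trib_rep n.
Proof.
move=> lt_n; rewrite -(strip_greedy n lt_n) addnC /trib_rep.
exact: strip_greedy (trib_gt n).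
Qed.

Lemma foldl_strip (S : Type) (f : S -> bool -> S) s w :
  f s false = s -> foldl f s (strip_zeros w) = foldl f s w.
Proof.
by move=> fs; rewrite /strip_zeros; elim: w => // -[] //= w ->; rewrite fs.
Qed.

Lemma greedyS k n : greedy k.+1 n =
  if trib k.+2 <= n then true :: greedy k (n - trib k.+2) else false :: greedy k n.
Proof. by []. Qed.

Lemma nth_expand k l n : n < size (expand k l) ->
  nth letter0 (expand k l) n = foldl delta l (greedy k n).
Proof.
elim: k l n => [|k IH] l n; first by case: n.
have size0 : size (expand k (delta l false)) = trib k.+2.
  by case: l => [[a b] t]; rewrite /= size_expand.
rewrite [expand _ _]/= size_cat nth_cat size0 greedyS [trib _ <= _]leqNgt.
case: (ltnP n (trib k.+2)) => [lt_n _|le_n]; first by rewrite /= -IH ?size0.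
by case: ifP => _ /= lt_n; [rewrite -IH // | ]; lia.
Qed.

Lemma letter_wordE k n : n < size (expand k letter0) ->
  letter_word n = nth letter0 (expand k letter0) n.
Proof.
move=> lt_n; rewrite nth_expand // /letter_word -(@trib_rep_greedy k).
  exact: foldl_strip.
by rewrite size_expand in lt_n.
Qed.

Lemma size_coding_expansion k l :
  size (flatten (map coding (expand k l))) = size (expand (k + 3) l).
Proof.
rewrite expandD !size_flatten /shape -!map_comp; congr (sumn _).
by apply: eq_map => b; apply: size_coding_expand.
Qed.

(** The first [k] digits choose a letter of [expand k l], the last three a position in its block.
    Because of the delay, the first three digits only fill the buffer. *)
Lemma nth_coding k l n : n < size (flatten (map coding (expand k l))) ->
  nth false (flatten (map coding (expand k l))) n =
  if greedy k.+3 n is [:: d1, d2, d3 & w] then out (foldl trans (l, (d1, d2, d3)) w)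
  else false.
Proof.
elim: k l n => [|k IH] l n.
  rewrite [flatten _]/= cats0 => lt_n.
  have := greedy_val (_ : n < trib 5).
  have := size_greedy 3 n; case: (greedy 3 n) => [|d1 [|d2 [|d3 []]]] //= _ <- //.
  by have := size_coding l; rewrite (_ : trib 5 = 7) //; lia.
have size0 : size (flatten (map coding (expand k (delta l false)))) = trib k.+3.+2.
  by case: l => [[a b] t]; rewrite size_coding_expansion size_expand addn3.
have next j : exists d1 d2 d3 w, greedy k.+3 j = [:: d1, d2, d3 & w].
  by have := size_greedy k.+3 j; case: greedy => [|d1 [|d2 [|d3 w]]] // _; exists d1, d2, d3, w.
rewrite [expand _ _]/= map_cat flatten_cat size_cat nth_cat size0.
rewrite greedyS [trib _ <= _]leqNgt.
case: (ltnP n (trib k.+3.+2)) => [lt_n _|le_n].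
  rewrite IH ?size0 //.
  by have [d1 [d2 [d3 [w ->]]]] := next n.
case: ifP => _ lt_n; last by move: lt_n; rewrite /= addn0; lia.
rewrite IH; last by lia.
by have [d1 [d2 [d3 [w ->]]]] := next (n - trib k.+3.+2).
Qed.

Lemma bit_wordE k n : n < size (flatten (map coding (expand k letter0))) ->
  bit_word n = nth false (flatten (map coding (expand k letter0))) n.
Proof.
move=> lt_n; rewrite nth_coding // /bit_word /dfao_run.
rewrite size_coding_expansion size_expand addn3 in lt_n.
rewrite -(trib_rep_greedy lt_n) foldl_strip //.
by have := size_greedy k.+3 n; case: greedy => [|d1 [|d2 [|d3 w]]].
Qed.

Lemma trib_automatic_bit_word : trib_automatic bit_word.
Proof. by exists coding_dfao. Qed.

Lemma is_image_of_prefixes (B : Type) (b0 : B) (f : letter -> seq B) (x : nat -> B) :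
    (forall k n, n < size (flatten (map f (expand k letter0))) ->
       x n = nth b0 (flatten (map f (expand k letter0))) n) ->
  is_image f letter_word x b0.
Proof.
move=> prefixes j r lt_r; set s := expand j letter0.
have lt_j : j < size s by rewrite size_expand trib_gt.
have take_s : take j s = mkseq letter_word j.
  apply: (@eq_from_nth _ letter0); rewrite size_take lt_j ?size_mkseq // => i lt_i.
  rewrite nth_take // nth_mkseq // (@letter_wordE j) //; exact: ltn_trans lt_j.
have pos_j : block_pos f letter_word j = size (flatten (map f (take j s))).
  rewrite take_s size_flatten /shape sumnE !big_map /block_pos.
  by rewrite -(big_mkord xpredT (fun i => size (f (letter_word i)))) /index_iota subn0.
have s_split : s = take j s ++ letter_word j :: drop j.+1 s.
  by rewrite (@letter_wordE j) // -drop_nth // cat_take_drop.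
have fs_split : flatten (map f s) =
    flatten (map f (take j s)) ++ f (letter_word j) ++ flatten (map f (drop j.+1 s)).
  by rewrite {1}s_split map_cat flatten_cat.
rewrite (prefixes j) -/s fs_split pos_j.
  by rewrite nth_cat ltnNge leq_addr addKn nth_cat lt_r.
by rewrite !size_cat ltn_add2l; apply: leq_trans lt_r _; apply: leq_addr.
Qed.

Lemma is_image_expand k : is_image (expand k) letter_word letter_word letter0.
Proof.
apply: is_image_of_prefixes => j n; rewrite -expandD; exact: letter_wordE.
Qed.

Lemma is_image_coding : is_image coding letter_word bit_word false.
Proof. exact/is_image_of_prefixes/bit_wordE. Qed.

(** * Finite checks and descent *)

Definition window (B : Type) (b0 : B) (x : nat -> B) (i : nat) (w : seq B) : Prop :=
  forall k, k < size w -> nth b0 w k = x (i + k).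

Lemma window_image (B : Type) (b0 : B) (f : letter -> seq B) (x : nat -> B) j w :
    is_image f letter_word x b0 -> window letter0 letter_word j w ->
  window b0 x (block_pos f letter_word j) (flatten (map f w)).
Proof.
move=> im; elim: w j => // l w IH j win k.
have e_l : l = letter_word j by have := win 0 isT; rewrite addn0.
rewrite /= size_cat nth_cat e_l.
case: (ltnP k (size (f (letter_word j)))) => [lt_k _|le_k lt_k]; first by rewrite im.
rewrite (IH j.+1); last by lia.
  by rewrite block_posS; congr (x _); lia.
by move=> i lt_i; have := win i.+1 lt_i; rewrite addSnnS.
Qed.

Lemma window_drop (B : Type) (b0 : B) (x : nat -> B) i w r :
  window b0 x i w -> window b0 x (i + r) (drop r w).
Proof.
move=> win k; rewrite size_drop nth_drop => lt_k.
by rewrite win ?addnA //; lia.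
Qed.

Lemma agree_matches (B : eqType) (b0 : B) (x : nat -> B) i p e w :
  window b0 x i w -> matches x i p e -> agree e w (drop p w).
Proof.
move=> win mat; apply: (@agreeP _ b0) => k lt_e lt_w lt_d.
by rewrite win // (window_drop win) //; apply: mat.
Qed.

Lemma no_matchP (B : eqType) (b0 : B) (x : nat -> B) i e ps w p :
  window b0 x i w -> no_match e ps w -> p \in ps -> ~ matches x i p (e p).
Proof.
move=> win /allP nm /nm /negP ndis mat; apply: ndis; exact: (agree_matches win mat).
Qed.

Lemma pairs_closed : all (fun ab => let w := expand 1 ab.1 ++ expand 1 ab.2 in
  all (fun r => (nth letter0 w r, nth letter0 w r.+1) \in pairs)
    (iota 0 (size (expand 1 ab.1)))) pairs.
Proof. by vm_compute. Qed.

Lemma block_pos_expand1_gt j : 0 < j -> j < block_pos (expand 1) letter_word j.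
Proof.
case: j => // j _; elim: j => [|j IH]; first by rewrite block_posS /block_pos big_ord0.
by rewrite block_posS; have := size_expand_bounds 1 (letter_word j.+1); lia.
Qed.

(** For [j > 0], places [j] and [j.+1] lie in the images of two consecutive letters, the first of
    index below [j] because the first block has two letters. *)
Lemma pair_mem j : (letter_word j, letter_word j.+1) \in pairs.
Proof.
have [n] := ubnP j; elim: n j => // n IH j lt_j.
case: (posnP j) => [->|j_gt0]; first by vm_compute.
have [q [r [lt_r e_j]]] := block_posP letter_word (ltn0Sn 0) (size_expand_bounds 1) j.
have lt_q : q < j.
  by case: (posnP q) => [->//|/block_pos_expand1_gt]; lia.
have /(allP pairs_closed) /allP/(_ r) := IH q (leq_trans lt_q lt_j : q < n).
rewrite mem_iota => /(_ lt_r) /=.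
have win : window letter0 letter_word q [:: letter_word q; letter_word q.+1].
  by case=> [|[|]] //=; rewrite ?addn0 ?addn1.
have := window_image (@is_image_expand 1) win.
rewrite [flatten _]/= cats0 => win1.
have sz : r.+1 < size (expand 1 (letter_word q) ++ expand 1 (letter_word q.+1)).
  by rewrite size_cat; have := size_expand_bounds 1 (letter_word q.+1); lia.
by have := win1 r (ltnW sz); have := win1 _ sz => /= -> ->; rewrite addnS -e_j.
Qed.

Lemma factorsP n j : exists l w,
  [/\ l :: w \in factors n, l = letter_word j & window letter0 letter_word j (l :: w)].
Proof.
have [q [r [lt_r ->]]] := block_posP letter_word (ltn0Sn 0) (size_expand_bounds n) j.
have win : window letter0 letter_word q [:: letter_word q; letter_word q.+1].
  by case=> [|[|]] //=; rewrite ?addn0 ?addn1.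
have := window_image (@is_image_expand n) win.
rewrite [flatten _]/= cats0 => /(@window_drop _ _ _ _ _ r).
have : drop r (expand n (letter_word q) ++ expand n (letter_word q.+1)) \in factors n.
  apply/allpairsPdep; exists (letter_word q, letter_word q.+1), r.
  by rewrite pair_mem mem_iota.
have : 0 < size (drop r (expand n (letter_word q) ++ expand n (letter_word q.+1))).
  by rewrite size_drop size_cat; lia.
case: drop => // l w _ mem_w winw; exists l, w; split=> //.
by have := winw 0 isT; rewrite addn0.
Qed.

Lemma recognizableP (B : eqType) (b0 : B) (f : letter -> seq B) (x : nat -> B) n W :
    is_image f letter_word x b0 -> recognizableb f n W ->
  recognizable f letter_word x W.
Proof.
move=> im rec j j' r lt_r eq_x.
have [l [w [mem_w e_l /(window_image im) win]]] := factorsP n j.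
have [l' [w' [mem_w' e_l' /(window_image im) win']]] := factorsP n j'.
subst l l'.
have memT u : u \in factors n -> (head letter0 u, flatten (map f u)) \in
    [seq (head letter0 w, flatten (map f w)) | w <- factors n] by move=> mem_u; apply: map_f.
have /(allP rec)/allP/(_ _ (memT _ mem_w'))/allP/(_ r) := memT _ mem_w.
rewrite mem_iota /= => /(_ lt_r) /implyP H.
have [|/eqP e /eqP r0] := andP (H _); last by [].
apply: (@agreeP _ b0) => k lt_k lt_w lt_w'; rewrite win //.
by rewrite (window_drop win') //; apply: eq_x.
Qed.

Lemma recognizable_expand2 : recognizable (expand 2) letter_word letter_word 4.
Proof. by apply: (recognizableP (n := 4) (@is_image_expand 2)); vm_compute. Qed.

Lemma recognizable_coding : recognizable coding letter_word bit_word 20.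
Proof. by apply: (recognizableP (n := 4) is_image_coding); vm_compute. Qed.

Lemma letter_word_small : all (no_match (subn^~ 6) (iota 10 30)) (factors 8).
Proof. by vm_compute. Qed.

(** The slack 6 reproduces itself, as 6 + 4 + 4 <= 2 * 7 + 1. A period [p >= 40] descends to one
    between [p / 4] and [p / 2], so smaller and still at least 10. *)
Lemma letter_word_no_match p i : 10 <= p -> ~ matches letter_word i p (p - 6).
Proof.
have [n] := ubnP p; elim: n p i => // n IH p i lt_n ge_p mat.
have [lt_p|le_p] := ltnP p 40.
  have [l [w [/(allP letter_word_small) nm _ win]]] := factorsP 8 i.
  by apply: (no_matchP win nm _ mat); rewrite mem_iota ge_p.
have [|||i' [p' [mat' bnd]]] := matches_descent (c' := 6) (isT : 0 < 2) size_expand2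
    (@is_image_expand 2) recognizable_expand2 _ _ _ mat => //; try lia.
by apply: IH mat'; lia.
Qed.

Lemma bit_word_small : all (fun w => let v := flatten (map coding w) in
    all (fun r => no_match (fun p => (4 * p %/ 3).+1) (iota 1 69) (drop r v))
      (iota 0 (size (coding (head letter0 w))))) (factors 7).
Proof. by vm_compute. Qed.

(** The length is the least one exceeding [4 * p / 3]. From 70 = 7 * 10 on, even squares are
    impossible: as 20 + 7 <= 4 * 7 + 1, they descend with slack 6 to a period at least 10. *)
Lemma bit_word_no_match p i : 0 < p -> ~ matches bit_word i p (4 * p %/ 3).+1.
Proof.
move=> p_gt0 mat; have [lt_p|le_p] := ltnP p 70.
  have [j [r [lt_r e_i]]] := block_posP letter_word (isT : 0 < 4) size_coding i.
  have [l [w [/(allP bit_word_small)/allP/(_ r) nm e_l win]]] := factorsP 7 j.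
  have := window_drop (r := r) (window_image (@is_image_coding) win); rewrite -e_i => winr.
  apply: (no_matchP winr (nm _) _ mat); last by rewrite mem_iota; lia.
  by rewrite mem_iota /= e_l.
have mat0 : matches bit_word i p (p - 0) by move=> k lt_k; apply: mat; lia.
have [|||i' [p' [mat' bnd]]] := matches_descent (c' := 6) (isT : 0 < 4) size_coding
    is_image_coding recognizable_coding _ _ _ mat0 => //; try lia.
by apply: (@letter_word_no_match p' i') => //; lia.
Qed.

(** * Exponents *)

Lemma onth_mkseq (A : Type) (g : nat -> A) n k : k < n -> onth (mkseq g n) k = Some (g k).
Proof.
by move=> lt_k; rewrite onthE /mkseq -map_comp (nth_map 0) ?size_iota //= nth_iota.
Qed.

Lemma is_period_mkseq (A : eqType) (a : nat -> A) i n p :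
  is_period (mkseq (fun j => a (i + j)) n) p <->
  0 < p <= n /\ matches a i p (n - p).
Proof.
rewrite /is_period size_mkseq; split=> [/andP[bnd /forallP per]|[bnd mat]].
  split=> // k lt_k; have /eqP := per (Ordinal lt_k).
  rewrite !onth_mkseq /=; [|lia|lia] => -[->].
  by rewrite -addnA [p + k]addnC.
rewrite bnd /=; apply/forallP => -[k lt_k] /=.
by rewrite !onth_mkseq; [rewrite mat // -addnA [p + k]addnC|lia|lia].
Qed.

Lemma exponent_le (R : realType) (A : eqType) (w : seq A) (c d : nat) : w <> [::] -> 0 < d ->
  (exponent R w <= c%:R / d%:R)%R = (d * size w <= c * least_period w).
Proof.
move=> /least_periodP[/andP[/andP[lp_gt0 _] _] _] d_gt0.
rewrite /exponent ler_pdivrMr ?ltr0n // mulrAC ler_pdivlMr ?ltr0n //.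
by rewrite -!natrM ler_nat mulnC.
Qed.

Lemma critical_exponent_bit_word (R : realType) :
  (critical_exponent R bit_word <= (7%:R / 3%:R)%:E)%E.
Proof.
apply: ge_ereal_sup => _ [w [[i e_w] w0] <-].
rewrite lee_fin exponent_le //; have [per _] := least_periodP w0.
rewrite leqNgt; apply/negP => lt_p; move: per.
rewrite {1}e_w => /is_period_mkseq[/andP[p_gt0 _] mat].
by apply: (@bit_word_no_match (least_period w) i) => // k lt_k; apply: mat; lia.
Qed.

Lemma critical_exponent_ge (R : realType) (a : nat -> bool) :
  ~ avoids_7_3 a -> ((7%:R / 3%:R)%:E <= critical_exponent R a)%E.
Proof.
move=> nav; rewrite leNgt; apply/negP => lt_ce; apply: nav => i p e p_gt0 le_p mat.
pose w := mkseq (fun j => a (i + j)) (p + e).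
have sz_w : size w = p + e by rewrite size_mkseq.
have w0 : w <> [::] by move=> w_nil; move: sz_w; rewrite w_nil /=; lia.
(* A least period below [p] only raises the exponent. *)
have le_lp : least_period w <= p.
  apply: (least_periodP w0).2; apply/is_period_mkseq.
  by rewrite p_gt0 leq_addr addKn.
have : (exponent R w < 7%:R / 3%:R)%R.
  rewrite -lte_fin; apply: le_lt_trans lt_ce; apply: ereal_sup_ubound.
  by exists w => //; split=> //; exists i; rewrite sz_w.
have [/andP[/andP[lp_gt0 _] _] _] := least_periodP w0.
rewrite ltNge => /negP; apply; rewrite ler_pdivlMr ?ltr0n // mulrAC.
by rewrite ler_pdivrMr ?ltr0n // -!natrM ler_nat sz_w; lia.
Qed.

Local Open Scope ring_scope.

Theorem theorem13 (R : realType) :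
  repetition_threshold R binary_trib_automatic = (7%:R / 3%:R)%:E.
Proof.
apply/eqP; rewrite eq_le; apply/andP; split.
  apply: le_trans (critical_exponent_bit_word R); apply: ereal_inf_lbound.
  by exists bit_word => //; exact: trib_automatic_bit_word.
apply: le_ereal_inf_tmp => _ [a aut <-].
exact/critical_exponent_ge/trib_automatic_7_3.
Qed.
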